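(* Let $\mathcal{K}_0\subseteq\mathbb{R}^{n_1}$, $\mathcal{K}_i\subseteq\mathbb{R}^{n_2}$, $i\in[1:S]$, be closed convex cones, and let $A\in\mathcal{S}^{n_1}$, $a\in\mathbb{R}^{n_1}$, $B_i\in\mathbb{R}^{n_1\times n_2}$, $C_i\in\mathcal{S}^{n_2}$, $c_i\in\mathbb{R}^{n_2}$, $F_i\in\mathbb{R}^{m_i\times n_1}$, $G_i\in\mathbb{R}^{m_i\times n_2}$, $r_i\in\mathbb{R}^{m_i}$ for $i\in[1:S]$, and let $\hat Q_j$, $j\in[1:K]$, be real-valued affine-linear functions of $(x,X,y_1,Z_1,Y_1,\dots,y_S,Z_S,Y_S)$. For variables $x\in\mathbb{R}^{n_1}$, $X\in\mathcal{S}^{n_1}$, $y_i\in\mathbb{R}^{n_2}$, $Z_i\in\mathbb{R}^{n_2\times n_1}$, $Y_i\in\mathcal{S}^{n_2}$, consider the objective function $$\operatorname{tr}(AX)+a^{\mathsf T}x+\sum_{i=1}^S\left[\operatorname{tr}(B_iZ_i)+\operatorname{tr}(C_iY_i)+c_i^{\mathsf T}y_i\right]$$ and the linear constraints $$\text{(L)}\quad F_ix+G_iy_i=r_i,\quad \operatorname{diag}\left(\begin{pmatrix}F_i&G_i\end{pmatrix}\begin{pmatrix}X&Z_i^{\mathsf T}\\ Z_i&Y_i\end{pmatrix}\begin{pmatrix}F_i^{\mathsf T}\\ G_i^{\mathsf T}\end{pmatrix}\right)=r_i\circ r_i\quad (i\in[1:S]),$$ $$\hat Q_j(x,X,y_1,Z_1,Y_1,\dots,y_S,Z_S,Y_S)=0\quad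 (j\in[1:K]).$$ Let $\mathrm{val}(SDP)$ be the optimal value of minimizing the objective subject to (L) and the constraint that, with additional variables $Y_{i,j}\in\mathbb{R}^{n_2\times n_2}$ ($i\ne j$) and $Y_{i,i}=Y_i$, $$\begin{pmatrix}1&x^{\mathsf T}&y_1^{\mathsf T}&\cdots&y_S^{\mathsf T}\\ x&X&Z_1^{\mathsf T}&\cdots&Z_S^{\mathsf T}\\ y_1&Z_1&Y_{1,1}&\cdots&Y_{1,S}\\ \vdots&\vdots&\vdots&\ddots&\vdots\\ y_S&Z_S&Y_{S,1}&\cdots&Y_{S,S}\end{pmatrix}\in\mathcal{S}_+^{n_1+Sn_2+1}.$$ Let $\mathrm{val}(R)$ be the optimal value of minimizing the objective subject to (L) and $$\begin{pmatrix}1&x^{\mathsf T}&y_i^{\mathsf T}\\ x&X&Z_i^{\mathsf T}\\ y_i&Z_i&Y_i\end{pmatrix}\in\mathcal{CPP}(\mathbb{R}_+\times\mathcal{K}_0\times\mathcal{K}_i),\quad i\in[1:S].$$ Then $\mathrm{val}(SDP)\le\mathrm{val}(R)$. The statement also holds if, in the definition of $\mathrm{val}(R)$, the cones $\mathcal{CPP}(\mathbb{R}_+\times\mathcal{K}_0\times\mathcal{K}_i)$, $i\in[1:S]$, are replaced by any other subsets of $\mathcal{S}_+^{n_1+n_2+1}$.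
   Context: Notation: $[1:S]=\{1,\dots,S\}$; $\mathcal{S}^m$ is the space of real symmetric $m\times m$ matrices and $\mathcal{S}^m_+$ the cone of positive semidefinite ones; $\circ$ is the elementwise product of vectors; $\operatorname{diag}(M)$ is the vector of diagonal entries of $M$. For a closed convex cone $\mathcal{K}\subseteq\mathbb{R}^m$ the set-completely positive cone is $\mathcal{CPP}(\mathcal{K}):=\{\sum_{l=1}^{p}x_lx_l^{\mathsf T} : x_l\in\mathcal{K},\ p\in\mathbb{N}\}$. Optimal values are infima in $[-\infty,+\infty]$, with value $+\infty$ for infeasible problems. (In the application the $\hat Q_j$ are linearizations of quadratic functions $Q_j(x,y_1,\dots,y_S)$ having no bilinear terms between $y_i$ and $y_l$ for $i\ne l$, i.e. $\hat Q_j(x,xx^{\mathsf T},y_1,y_1x^{\mathsf T},y_1y_1^{\mathsf T},\dots,y_S,y_Sx^{\mathsf T},y_Sy_S^{\mathsf T})=Q_j(x,y_1,\dots,y_S)$.) *)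

(* Defs.v *)
From HB Require Import structures.
From mathcomp Require Import all_boot all_order all_algebra.
From mathcomp Require Import all_classical all_reals all_analysis.

Set Implicit Arguments.
Unset Strict Implicit.
Unset Printing Implicit Defensive.

Import Order.TTheory GRing.Theory Num.Theory.
Import numFieldNormedType.Exports.

Local Open Scope classical_set_scope.
Local Open Scope ring_scope.

Definition symm (R : realType) (m : nat) : set 'M[R]_m := [set M | M^T = M].
Arguments symm : clear implicits.

Definition psd (R : realType) (m : nat) : set 'M[R]_m :=
  [set M | symm R m M /\ forall u : 'cV[R]_m, 0 <= (u^T *m M *m u) 0 0].
Arguments psd : clear implicits.

Definition closed_convex_cone (R : realType) (m : nat) (K : set 'cV[R]_m) :=
  [/\ K !=set0,
      closed K,
      convex_set (K : set (convex_lmodType 'cV[R]_m)) &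
      forall (t : R) (u : 'cV[R]_m), 0 <= t -> K u -> K (t *: u)].

Definition cpp (R : realType) (m : nat) (K : set 'cV[R]_m) : set 'M[R]_m :=
  [set M | exists (p : nat) (u : 'I_p -> 'cV[R]_m),
     (forall l, K (u l)) /\ M = \sum_(l < p) u l *m (u l)^T].

(* The product cone R_+ x K0 x K1, its elements stacked into one column. *)
Definition prod_cone (R : realType) (n1 n2 : nat)
    (K0 : set 'cV[R]_n1) (K1 : set 'cV[R]_n2) : set 'cV[R]_(1 + (n1 + n2)) :=
  [set w | exists (t : R) (x : 'cV[R]_n1) (y : 'cV[R]_n2),
     [/\ 0 <= t, K0 x, K1 y & w = col_mx t%:M (col_mx x y)]].

(* Tuples (x, X, (y_i, Z_i, Y_i)_i); X and the Y_i range over all square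
   matrices here, and their symmetry is imposed by [symm_vars].  Keeping the
   ambient space an lmodType loses no affine function: one defined on the
   subspace of tuples with symmetric X and Y_i extends to the whole space. *)
Definition vars (R : realType) (n1 n2 S : nat) : lmodType R :=
  ('cV[R]_n1 * 'M[R]_n1 *
   {ffun 'I_S -> 'cV[R]_n2 * 'M[R]_(n2, n1) * 'M[R]_n2})%type.

Section Vars.
Variables (R : realType) (n1 n2 S : nat).
Implicit Types v : vars R n1 n2 S.

Definition vx v : 'cV[R]_n1 := v.1.1.
Definition vX v : 'M[R]_n1 := v.1.2.
Definition vy v (i : 'I_S) : 'cV[R]_n2 := (v.2 i).1.1.
Definition vZ v (i : 'I_S) : 'M[R]_(n2, n1) := (v.2 i).1.2.
Definition vY v (i : 'I_S) : 'M[R]_n2 := (v.2 i).2.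

Definition symm_vars : set (vars R n1 n2 S) :=
  [set v | symm R n1 (vX v) /\ forall i, symm R n2 (vY v i)].

Definition affine_linear (Q : vars R n1 n2 S -> R) :=
  exists (f : {linear vars R n1 n2 S -> R^o}) (c : R), forall v, Q v = f v + c.

Definition objective (A : 'M[R]_n1) (a : 'cV[R]_n1) (B : 'I_S -> 'M[R]_(n1, n2))
    (C : 'I_S -> 'M[R]_n2) (c : 'I_S -> 'cV[R]_n2) v : R :=
  \tr (A *m vX v) + (a^T *m vx v) 0 0 +
  \sum_(i < S) (\tr (B i *m vZ v i) + \tr (C i *m vY v i) +
                ((c i)^T *m vy v i) 0 0).

Definition lin_constraints (m : 'I_S -> nat) (F : forall i, 'M[R]_(m i, n1))
    (G : forall i, 'M[R]_(m i, n2)) (r : forall i, 'cV[R]_(m i))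
    (K : nat) (Q : 'I_K -> vars R n1 n2 S -> R) : set (vars R n1 n2 S) :=
  [set v | [/\ forall i, F i *m vx v + G i *m vy v i = r i,
     forall i, \col_k (row_mx (F i) (G i) *m
                       block_mx (vX v) (vZ v i)^T (vZ v i) (vY v i) *m
                       col_mx (F i)^T (G i)^T) k k
               = map2_mx *%R (r i) (r i) &
     forall j, Q j v = 0]].

Definition small_mx v (i : 'I_S) : 'M[R]_(1 + (n1 + n2)) :=
  block_mx 1%:M (row_mx (vx v)^T (vy v i)^T)
           (col_mx (vx v) (vy v i))
           (block_mx (vX v) (vZ v i)^T (vZ v i) (vY v i)).

Definition big_mx v (YY : 'I_S -> 'I_S -> 'M[R]_n2) :
    'M[R]_(1 + (n1 + \sum_(i < S) n2)) :=
  block_mx 1%:M (row_mx (vx v)^T (\mxrow_(i < S) (vy v i)^T))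
           (col_mx (vx v) (\mxcol_(i < S) vy v i))
           (block_mx (vX v) (\mxrow_(i < S) (vZ v i)^T)
                     (\mxcol_(i < S) vZ v i) (\mxblock_(i < S, j < S) YY i j)).

Definition feas_sdp (L : set (vars R n1 n2 S)) : set (vars R n1 n2 S) :=
  [set v | [/\ symm_vars v, L v &
     exists YY : 'I_S -> 'I_S -> 'M[R]_n2,
       (forall i, YY i i = vY v i) /\ psd R _ (big_mx v YY)]].

Definition feas_rel (L : set (vars R n1 n2 S))
    (D : 'I_S -> set 'M[R]_(1 + (n1 + n2))) : set (vars R n1 n2 S) :=
  [set v | [/\ symm_vars v, L v & forall i, D i (small_mx v i)]].

(* Infimum in [-oo, +oo]; the infimum of the empty set is +oo. *)
Definition opt_val (obj : vars R n1 n2 S -> R) (feas : set (vars R n1 n2 S)) :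
    \bar R :=
  ereal_inf [set (obj v)%:E | v in feas].

End Vars.

(* Main.v *)
(** The matrix completion is explicit.  All the matrices of the relaxation share
    the principal block [H = [[1, x^T], [x, X]]], and each is positive
    semidefinite, so with [W_i = (y_i, Z_i)] the kernel of [H] is annihilated by
    [W_i], whence [W_i = T_i H], and the Schur complement [Y_i - T_i H T_i^T] is
    positive semidefinite.  Setting [Y_(i,j) = T_i H T_j^T] off the diagonal,
    the generalized Schur complement of [H] in the large matrix is block
    diagonal with these positive semidefinite blocks. *)
Require Import Defs.
From mathcomp Require Import all_boot all_order all_algebra.
From mathcomp Require Import all_classical all_reals all_analysis.
From mathcomp Require Import ring lra.

Set Implicit Arguments.
Unset Strict Implicit.
Unset Printing Implicit Defensive.

Import Order.TTheory GRing.Theory Num.Theory.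
Import numFieldNormedType.Exports.

Local Open Scope classical_set_scope.
Local Open Scope ring_scope.

Section PositiveSemidefinite.
Context {R : realType}.

Lemma psd0 m : psd R m 0.
Proof. by split=> [|u]; rewrite /symm /= ?trmx0 // mulmx0 mul0mx mxE. Qed.

Lemma psdD m (M N : 'M[R]_m) : psd R m M -> psd R m N -> psd R m (M + N).
Proof.
move=> [Ms Mp] [Ns Np]; split=> [|u]; first by rewrite /symm /= linearD /= Ms Ns.
by rewrite mulmxDr mulmxDl mxE addr_ge0.
Qed.

Lemma psd_congr m n (L : 'M[R]_(n, m)) (M : 'M[R]_m) :
  psd R m M -> psd R n (L *m M *m L^T).
Proof.
move=> [Ms Mp]; split=> [|u].
  by rewrite /symm /= !trmx_mul trmxK Ms mulmxA.
by have := Mp (L^T *m u); rewrite trmx_mul trmxK !mulmxA.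
Qed.

Lemma mulmx_tr_ge0 m (z : 'cV[R]_m) : 0 <= (z^T *m z) 0 0.
Proof. by rewrite mxE sumr_ge0 // => i _; rewrite mxE -expr2 sqr_ge0. Qed.

Lemma mulmx_tr_eq0 m (z : 'cV[R]_m) : (z^T *m z) 0 0 = 0 -> z = 0.
Proof.
rewrite mxE => /eqP; rewrite psumr_eq0 => [/allP z0|i _]; last first.
  by rewrite mxE -expr2 sqr_ge0.
apply/colP => i; have := z0 i (mem_index_enum i).
by rewrite !mxE -expr2 sqrf_eq0 => /eqP.
Qed.

Lemma psd1 m : psd R m 1%:M.
Proof.
split=> [|u]; first by rewrite /symm /= trmx1.
by rewrite mulmx1 mulmx_tr_ge0.
Qed.

Lemma psd_castmx m n (e : m = n) (M : 'M[R]_m) :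
  psd R n (castmx (e, e) M) <-> psd R m M.
Proof. by case: _ / e; rewrite castmx_id. Qed.

Lemma cpp_psd m (K : set 'cV[R]_m) : cpp K `<=` psd R m.
Proof.
move=> _ [p [u [_ ->]]]; elim/big_ind: _ => [|M N|l _].
- exact: psd0.
- exact: psdD.
(* A rank-one term is the congruence of the 1 by 1 identity by [u l]. *)
- by rewrite -[X in X *m _]mulmx1; apply/psd_congr/psd1.
Qed.

Lemma psd_mxdiag p (q : 'I_p -> nat) (D : forall i, 'M[R]_(q i)) :
  (forall i, psd R _ (D i)) -> psd R _ (\mxdiag_i D i).
Proof.
move=> Dp; split=> [|u].
  by rewrite /symm /= tr_mxdiag; apply: eq_mxdiag => i; case: (Dp i).
rewrite -[u]submxcolK tr_mxcol -mulmxA mul_mxdiag_mxcol mul_mxrow_mxcol summxE.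
by apply: sumr_ge0 => i _; rewrite mulmxA; case: (Dp i).
Qed.

(** Evaluated at [(t v, W v)], the quadratic form loses its [t ^ 2] term because [H v = 0]. It is
    then affine in [t] with slope twice the squared norm of [W v], and it can stay nonnegative for
    all [t] only if that slope vanishes. *)
Lemma psd_block_ker m n (H : 'M[R]_m) (W : 'M[R]_(n, m)) (Y : 'M[R]_n)
    (v : 'cV[R]_m) :
  psd R _ (block_mx H W^T W Y) -> H *m v = 0 -> W *m v = 0.
Proof.
move=> [_ Mp] Hv; set z := W *m v; apply: mulmx_tr_eq0.
set q := (_ *m _) _ _; pose b := (z^T *m Y *m z) 0 0.
have form t : 0 <= b + 2 * t * q.
  have := Mp (col_mx (t *: v) z); rewrite -mulmxA mul_block_col tr_col_mx.
  rewrite -scalemxAr Hv scaler0 add0r mul_row_col -scalemxAr -/z.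
  have -> : (t *: v)^T *m (W^T *m z) = t *: (z^T *m z).
    by rewrite linearZ /= -scalemxAl mulmxA -trmx_mul.
  rewrite mulmxDr -scalemxAr mulmxA addrA -scalerDl addrC mxE -/b [X in _ + X]mxE -/q.
  by rewrite -mulr2n mulr_natl.
have q0 : 0 <= q by exact: mulmx_tr_ge0.
apply/eqP; rewrite eq_le q0 andbT leNgt; apply/negP => qp.
(* This [t] makes the affine form equal to -1. *)
have := form (- (b + 1) / (2 * q)).
have -> : b + 2 * (- (b + 1) / (2 * q)) * q = -1 by field; rewrite gt_eqF.
lra.
Qed.

(** Generalized Schur complement for a possibly singular [H]: the factor [T] stands in for [W] times
    a pseudo-inverse of [H]. *)
Lemma psd_schur m n (H : 'M[R]_m) (W : 'M[R]_(n, m)) (Y : 'M[R]_n) :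
  psd R _ (block_mx H W^T W Y) <->
  psd R _ H /\ exists T, W = T *m H /\ psd R _ (Y - T *m H *m T^T).
Proof.
split=> [Mp|[Hp [T [WT Dp]]]].
- have Hp : psd R _ H.
    have := psd_congr (row_mx 1%:M 0) Mp.
    rewrite mul_row_block tr_row_mx mul_row_col trmx0 trmx1.
    by rewrite !mulmx1 !mul1mx !mul0mx mulmx0 !addr0.
  (* Row space inclusion is tested on the columns of [cokermx H]: [H] kills each of them, hence so
     does [W]. *)
  have /submxP[T WT] : (W <= H)%MS.
    rewrite submxE; apply/eqP/trmx_inj/row_matrixP => j; rewrite -!tr_col.
    rewrite !colE mul0mx -mulmxA (psd_block_ker Mp) //.
    by rewrite mulmxA mulmx_coker mul0mx.
  split=> //; exists T; split=> //.
  (* Block elimination: this congruence cancels [W] against [T *m H] and leaves the Schur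
     complement. *)
  have := psd_congr (row_mx (- T) 1%:M) Mp.
  rewrite mul_row_block tr_row_mx mul_row_col trmx1 mulmx1 !mul1mx.
  rewrite !mulNmx WT addNr mul0mx add0r trmx_mul.
  by case: (Hp) => -> _; rewrite mulmxA addrC.
(* Completing the square splits the matrix into congruences of [H] and of its Schur complement. *)
- have -> : block_mx H W^T W Y = col_mx 1%:M T *m H *m (col_mx 1%:M T)^T
      + col_mx 0 1%:M *m (Y - T *m H *m T^T) *m (col_mx 0 1%:M)^T.
    rewrite !tr_col_mx (mul_col_mx _ _ H) (mul_col_mx _ _ (Y - _)) !mul_col_row.
    rewrite !trmx0 !trmx1.
    rewrite !mulmx1 !mul1mx !mulmx0 !mul0mx add_block_mx !addr0.
    by rewrite [_ + (Y - _)]addrC subrK WT trmx_mul; case: (Hp) => -> _.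
  by apply: psdD; exact: psd_congr.
Qed.

(** Reassociates the blocks so that the part shared by all the constraints becomes the leading
    block. *)
Lemma psd_block3 m n p (a : 'M[R]_m) (x : 'M[R]_(n, m)) (X : 'M[R]_n)
    (y : 'M[R]_(p, m)) (Z : 'M[R]_(p, n)) (Y : 'M[R]_p) :
  psd R _ (block_mx a (row_mx x^T y^T) (col_mx x y) (block_mx X Z^T Z Y)) <->
  psd R _ (block_mx (block_mx a x^T x X) (row_mx y Z)^T (row_mx y Z) Y).
Proof. by rewrite block_mxA psd_castmx tr_row_mx. Qed.

Lemma psd_completion m p (q : 'I_p -> nat) (H : 'M[R]_m)
    (W : forall i, 'M[R]_(q i, m)) (Y : forall i, 'M[R]_(q i)) :
  (0 < p)%N -> (forall i, psd R _ (block_mx H (W i)^T (W i) (Y i))) ->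
  exists YY : forall i j, 'M[R]_(q i, q j), (forall i, YY i i = Y i) /\
    psd R _ (block_mx H (\mxcol_i W i)^T (\mxcol_i W i) (\mxblock_(i, j) YY i j)).
Proof.
(* Positive semidefiniteness of [H] is read off one of the given matrices, so at least one index
   must exist. *)
move=> p0 /(_ _)/psd_schur Mp; have [Hp _] := Mp (Ordinal p0).
pose T i := projT1 (cid (Mp i).2).
have WT i : W i = T i *m H /\ psd R _ (Y i - T i *m H *m (T i)^T).
  by rewrite /T; case: cid.
pose D i := Y i - T i *m H *m (T i)^T.
(* The second summand is [D i] on the diagonal and zero off it; taking it from [\mxdiag_i D i]
   avoids a cast between the sizes [q i] and [q j]. *)
exists (fun i j => T i *m H *m (T j)^T + submxblock (\mxdiag_i D i) i j).
split=> [i|]; first by rewrite submxblock_diag addrC subrK.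
apply/psd_schur; split=> //; exists (\mxcol_i T i); split.
  by rewrite mxcol_mul; apply: eq_mxcol => i; case: (WT i).
rewrite mxblockD submxblockK tr_mxcol mxcol_mul mul_mxcol_mxrow addrC addKr.
by apply: psd_mxdiag => i; case: (WT i).
Qed.

End PositiveSemidefinite.

Lemma row_mx_mxcol (T : Type) p (q : 'I_p -> nat) m n
    (A : forall i, 'M[T]_(q i, m)) (B : forall i, 'M[T]_(q i, n)) :
  row_mx (\mxcol_i A i) (\mxcol_i B i) = \mxcol_i row_mx (A i) (B i).
Proof.
by apply/matrixP => k l; rewrite !mxE; case: fintype.split => j; rewrite !mxE.
Qed.

(** The completion only supplies the off-diagonal blocks, so the tuple [v], and with it the
    objective value, is unchanged. *)
Lemma feas_rel_sdp (R : realType) (n1 n2 S : nat) (L : set (vars R n1 n2 S))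
    (D : 'I_S -> set 'M[R]_(1 + (n1 + n2))) :
  (0 < S)%N -> (forall i, D i `<=` psd R (1 + (n1 + n2))) ->
  feas_rel L D `<=` feas_sdp L.
Proof.
move=> S0 Dp v [vs vL vD]; split=> //.
have Mp i : psd R _ (block_mx (block_mx 1%:M (vx v)^T (vx v) (vX v))
    (row_mx (vy v i) (vZ v i))^T (row_mx (vy v i) (vZ v i)) (vY v i)).
  exact/psd_block3/Dp/vD.
have [YY [YYi YYp]] := psd_completion S0 Mp.
exists YY; split=> //; rewrite /big_mx -!tr_mxcol.
by apply/psd_block3; rewrite row_mx_mxcol.
Qed.

Theorem theorem5 (R : realType) (n1 n2 S K : nat) (hS : (0 < S)%N)
  (K0 : set 'cV[R]_n1) (Ki : 'I_S -> set 'cV[R]_n2)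
  (hK0 : closed_convex_cone K0) (hKi : forall i, closed_convex_cone (Ki i))
  (A : 'M[R]_n1) (hA : symm R n1 A) (a : 'cV[R]_n1)
  (B : 'I_S -> 'M[R]_(n1, n2))
  (C : 'I_S -> 'M[R]_n2) (hC : forall i, symm R n2 (C i))
  (c : 'I_S -> 'cV[R]_n2)
  (m : 'I_S -> nat)
  (F : forall i, 'M[R]_(m i, n1)) (G : forall i, 'M[R]_(m i, n2))
  (r : forall i, 'cV[R]_(m i))
  (Q : 'I_K -> vars R n1 n2 S -> R) (hQ : forall j, affine_linear (Q j)) :
  let obj := objective A a B C c in
  let L := lin_constraints F G r Q in
  let val_SDP := opt_val obj (feas_sdp L) in
  let val_R := fun D : 'I_S -> set 'M[R]_(1 + (n1 + n2)) =>
                 opt_val obj (feas_rel L D) in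
  (val_SDP <= val_R (fun i => cpp (prod_cone K0 (Ki i))))%E /\
  (forall D : 'I_S -> set 'M[R]_(1 + (n1 + n2)),
     (forall i, D i `<=` psd R (1 + (n1 + n2))) ->
     (val_SDP <= val_R D)%E).
Proof.
move=> obj L val_SDP val_R.
have le_val D : (forall i, D i `<=` psd R (1 + (n1 + n2))) ->
    (val_SDP <= val_R D)%E.
  by move=> Dp; apply/ereal_inf_le_tmp/image_subset/feas_rel_sdp.
by split=> //; apply: le_val => i; exact: cpp_psd.
Qed.
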